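(* Let $\phi_1$ and $\phi_2$ be two bounded holomorphic quadratic differentials on the hyperbolic plane $\mathbb H^2$, and let $g_1$ and $g_2$ be the associated harmonic metrics, with quasi-conformal distortion factors $u_1$ and $u_2$. If $|\phi_1(x)|\ge|\phi_2(x)|$ for every $x\in\mathbb H^2$, then $u_1\le u_2$ on $\mathbb H^2$.
   Context: $g_0$ denotes the Poincaré metric of $\mathbb H^2$ (complete, curvature $-1$) and $\Delta$ its Laplace–Beltrami operator. A holomorphic quadratic differential is $\phi=\varphi(z)\,dz^2$ with $\varphi$ holomorphic in a conformal coordinate $z$; if $g_0=\sigma|dz|^2$, its norm is $|\phi|=|\varphi|/\sigma$, and $\phi$ is bounded if $\sup_{\mathbb H^2}|\phi|<\infty$. The expression $\phi+\bar\phi$ denotes $2\,\mathrm{Re}(\varphi\,dz^2)$. A metric $g$ on $\mathbb H^2$ is harmonic with respect to $g_0$ if the identity $(\mathbb H^2,g_0)\to(\mathbb H^2,g)$ is a harmonic map; its Hopf differential is the $(2,0)$-form $\phi$ such that $g=\phi+e\,g_0+\bar\phi$ for a function $e$. Associated harmonic metric: for a bounded holomorphic quadratic differential $\phi$, by a theorem of Wan there is a unique complete harmonic hyperbolic (curvature $-1$) metric with Hopf differential $\phi$; it is $g_\phi=\phi+(e^h+|\phi|^2e^{-h})g_0+\bar\phi$, where $h$ is the unique bounded solution of $\frac12\Delta h=e^h-|\phi|^2e^{-h}-1$, and it satisfies $h>\log|\phi|$. The quasi-conformal distortion factor (coefficient) of $g_\phi$ is $u=h-\log|\phi|$, with $u=+\infty$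 where $\phi=0$. *)

(* Defs.v *)
(* Stdlib reals with Coquelicot.  The hyperbolic plane is the Poincare disc:
   points are complex numbers z = (x, y) with Cmod z < 1, and z is the
   conformal coordinate.  All functions are total on C; only their values on
   the open disc matter. *)
From Stdlib Require Import Reals.
From Coquelicot Require Import Coquelicot.
Open Scope R_scope.

Definition in_disc (z : C) : Prop := Cmod z < 1.

(* Tensor calculus in the coordinates (x, y) *)

Inductive idx : Set := I1 | I2.

Definition idx_eqb (i j : idx) : bool :=
  match i, j with I1, I1 | I2, I2 => true | _, _ => false end.

Definition other (i : idx) : idx := match i with I1 => I2 | I2 => I1 end.

Definition coord (i : idx) (z : C) : R :=
  match i with I1 => fst z | I2 => snd z end.

Definition isum (f : idx -> R) : R := f I1 + f I2.

Definition partial (i : idx) (f : C -> R) (z : C) : R :=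
  match i with
  | I1 => Derive (fun t => f (t, snd z)) (fst z)
  | I2 => Derive (fun t => f (fst z, t)) (snd z)
  end.

(* Continuous differentiability of order n on the disc. *)
Definition Cn_on_disc (n : nat) (f : C -> R) : Prop :=
  forall x y : R, in_disc (x, y) -> ex_diff_n (fun a b => f (a, b)) n x y.

(* A covariant 2-tensor field, given by its coefficients g_ij. *)
Definition tensor2 : Type := idx -> idx -> C -> R.

(* The quadratic form g_z(v, v), for a tangent vector v = (v1, v2) viewed as a
   complex number. *)
Definition quad (g : tensor2) (z v : C) : R :=
  isum (fun i => isum (fun j => g i j z * coord i v * coord j v)).

Definition riemannian_metric (g : tensor2) : Prop :=
  (forall n i j, Cn_on_disc n (g i j)) /\
  (forall i j z, in_disc z -> g i j z = g j i z) /\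
  (forall z v, in_disc z -> v <> RtoC 0 -> 0 < quad g z v).

Definition det2 (g : tensor2) (z : C) : R :=
  g I1 I1 z * g I2 I2 z - g I1 I2 z * g I2 I1 z.

(* The coefficients g^ij of the inverse matrix. *)
Definition inverse2 (g : tensor2) : tensor2 := fun i j z =>
  (if idx_eqb i j then g (other i) (other j) z else - g i j z) / det2 g z.

(* Gamma^k_ij *)
Definition christoffel (g : tensor2) (k i j : idx) (z : C) : R :=
  / 2 * isum (fun l => inverse2 g k l z *
    (partial i (g j l) z + partial j (g i l) z - partial l (g i j) z)).

(* R(d_i, d_j) d_k = sum_l (riemann g l k i j) d_l, with
   R(X, Y) = [nabla_X, nabla_Y] - nabla_[X, Y]. *)
Definition riemann (g : tensor2) (l k i j : idx) (z : C) : R :=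
  partial i (christoffel g l j k) z - partial j (christoffel g l i k) z
  + isum (fun m => christoffel g l i m z * christoffel g m j k z
                   - christoffel g l j m z * christoffel g m i k z).

(* K = g(R(d_1, d_2) d_2, d_1) / det g *)
Definition gauss_curvature (g : tensor2) (z : C) : R :=
  isum (fun l => g I1 l z * riemann g l I2 I1 I2 z) / det2 g z.

(* Laplace-Beltrami operator, as the trace of the Hessian. *)
Definition laplacian (g : tensor2) (f : C -> R) (z : C) : R :=
  isum (fun i => isum (fun j => inverse2 g i j z *
    (partial i (partial j f) z
     - isum (fun k => christoffel g k i j z * partial k f z)))).

(* Tension field of a map F : (disc, g) -> (disc, g'). *)
Definition tension (g g' : tensor2) (F : C -> C) (k : idx) (z : C) : R :=
  laplacian g (fun w => coord k (F w)) z
  + isum (fun i => isum (fun j => inverse2 g i j z *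
      isum (fun a => isum (fun b => christoffel g' k a b (F z)
        * partial i (fun w => coord a (F w)) z
        * partial j (fun w => coord b (F w)) z)))).

Definition harmonic_map (g g' : tensor2) (F : C -> C) : Prop :=
  forall k z, in_disc z -> tension g g' F k z = 0.

(* c is a C^1 path in the disc from p to q, parametrised by [0, 1]. *)
Definition C1_path (c : R -> C) (p q : C) : Prop :=
  c 0 = p /\ c 1 = q /\
  forall t, 0 <= t <= 1 ->
    in_disc (c t) /\
    forall i, ex_derive (fun s => coord i (c s)) t /\
              continuous (Derive (fun s => coord i (c s))) t.

Definition velocity (c : R -> C) (t : R) : C :=
  (Derive (fun s => coord I1 (c s)) t, Derive (fun s => coord I2 (c s)) t).

Definition curve_length (g : tensor2) (c : R -> C) : R :=
  RInt (fun t => sqrt (quad g (c t) (velocity c t))) 0 1.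

Definition riem_dist (g : tensor2) (p q : C) : R :=
  real (Glb_Rbar (fun l => exists c, C1_path c p q /\ l = curve_length g c)).

Definition complete_metric (g : tensor2) : Prop :=
  forall s : nat -> C,
    (forall n, in_disc (s n)) ->
    (forall eps, 0 < eps -> exists N, forall m n,
       (N <= m)%nat -> (N <= n)%nat -> riem_dist g (s m) (s n) < eps) ->
    exists p, in_disc p /\ forall eps, 0 < eps -> exists N, forall n,
       (N <= n)%nat -> riem_dist g (s n) p < eps.

(* The Poincare metric g0 = sigma0 |dz|^2, of curvature -1 *)

Definition sigma0 (z : C) : R := 4 / (1 - Cmod z ^ 2) ^ 2.

Definition g0 : tensor2 := fun i j z => if idx_eqb i j then sigma0 z else 0.

(* A quadratic differential phi = f(z) dz^2 is represented by its coefficient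
   f : C -> C. *)

Definition holomorphic_on_disc (f : C -> C) : Prop :=
  forall z, in_disc z -> @ex_derive C_AbsRing C_NormedModule f z.

Definition qd_norm (phi : C -> C) (z : C) : R := Cmod (phi z) / sigma0 z.

Definition bounded_hqd (phi : C -> C) : Prop :=
  holomorphic_on_disc phi /\
  exists M, forall z, in_disc z -> qd_norm phi z <= M.

(* (phi + conj phi)(v, v) = 2 Re (f(z) dz(v)^2) *)
Definition re2 (phi : C -> C) (z v : C) : R := 2 * Re (Cmult (phi z) (Cmult v v)).

Definition has_hopf_differential (g : tensor2) (phi : C -> C) : Prop :=
  exists e : C -> R, forall z v, in_disc z ->
    quad g z v = re2 phi z v + e z * quad g0 z v.

Definition harmonic_metric (g : tensor2) : Prop :=
  riemannian_metric g /\ harmonic_map g0 g (fun z => z).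

Definition associated_harmonic_metric (phi : C -> C) (g : tensor2) : Prop :=
  harmonic_metric g /\ has_hopf_differential g phi /\
  (forall z, in_disc z -> gauss_curvature g z = -1) /\
  complete_metric g.

(* Bounded solutions of (1/2) Delta h = e^h - |phi|^2 e^(-h) - 1. *)
Definition bounded_solution (phi : C -> C) (h : C -> R) : Prop :=
  Cn_on_disc 2 h /\
  (exists M, forall z, in_disc z -> Rabs (h z) <= M) /\
  forall z, in_disc z ->
    / 2 * laplacian g0 h z = exp (h z) - qd_norm phi z ^ 2 * exp (- h z) - 1.

(* g = phi + (e^h + |phi|^2 e^(-h)) g0 + conj phi *)
Definition is_g_phi (phi : C -> C) (h : C -> R) (g : tensor2) : Prop :=
  forall z v, in_disc z ->
    quad g z v = re2 phi z v
      + (exp (h z) + qd_norm phi z ^ 2 * exp (- h z)) * quad g0 z v.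

(* u = h - log |phi|, with u = +oo at the zeros of phi, where h is the bounded
   solution giving the associated harmonic metric g of phi (its existence and
   uniqueness is Wan's theorem). *)
Definition is_distortion_factor (phi : C -> C) (g : tensor2) (u : C -> Rbar)
    : Prop :=
  exists h, bounded_solution phi h /\ is_g_phi phi h g /\
    forall z, in_disc z ->
      (phi z = RtoC 0 -> u z = p_infty) /\
      (phi z <> RtoC 0 -> u z = Finite (h z - ln (qd_norm phi z))).

(* Main.v *)
Require Import Defs.
From Stdlib Require Import Reals Lra ClassicalEpsilon.
From Coquelicot Require Import Coquelicot.
Open Scope R_scope.

(** Where [phi] does not vanish, [ln |phi|] has hyperbolic Laplacian [-2]: in
    the coordinate [z], [ln |phi|] is the logarithm of the modulus of a
    holomorphic function, which is harmonic, minus [ln sigma0], and the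
    curvature of [g0] is [-1].  Hence [u = h - ln |phi|] satisfies
    [1/2 Delta u = 2 |phi| sinh u].  If [u2 >= 0] and [|phi1| >= |phi2|], then
    at every point where [w = u1 - u2] is positive
    [[
      1/2 Delta w = 2 |phi1| sinh u1 - 2 |phi2| sinh u2
                 >= |phi2| e^u2 (e^w - 1) = e^h2 (e^w - 1) >= c w,
    ]]
    with [c > 0] because [h2] is bounded.  Since [w <= h1 - h2] is bounded
    above, [w] cannot be positive anywhere ([maximum_principle],
    [distortion_comparison]).  The inequality [u2 >= 0] follows from the same
    principle applied to [ln |phi2| - h2] ([distortion_nonneg]).

    Both [w] live only off the zeros of [phi2], and the disc is not compact.
    One function handles the zeros and infinity together:
    [q = ln |phi2| + ln (1 - |z|^2)] tends to [-oo] at every zero of [phi2] and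
    at the unit circle, [phi2] being bounded, and [Delta q = -3].  So
    [w + eps q] attains its maximum, at a point where [w > 0] and
    [0 >= Delta (w + eps q) >= 2 c w - 3 eps]; for small [eps] this
    contradicts the existence of a point with [w > 0].

    The harmonicity of [ln |phi|] needs two derivatives of [phi], whereas
    the definition of holomorphy gives one.  The metric provides them: the
    real and imaginary parts of a Hopf differential are linear combinations of
    the smooth coefficients [g_ij] ([hopf_coefficient_smooth]).  The Cauchy-Riemann equations and the symmetry
    of second derivatives do the rest ([is_laplacian_ln_norm]). *)

(** * Semicontinuous functions on a square *)

(** If the supremum [S] were not attained, each point [p] would have a
    neighbourhood on which [G < (S + G p) / 2].  Choosing its radius also below
    [(S - G p) / 2], a uniform lower bound [d] on the radii of a cover gives
    [G <= S - d] everywhere. *)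
Lemma usc_attains_max (G : R -> R -> R) (a b B : R) :
  a <= b ->
  (forall u v, a <= u <= b -> a <= v <= b -> G u v <= B) ->
  (forall u v m, a <= u <= b -> a <= v <= b -> G u v < m ->
     locally_2d (fun x y => G x y < m) u v) ->
  exists u v, a <= u <= b /\ a <= v <= b /\
    forall x y, a <= x <= b -> a <= y <= b -> G x y <= G u v.
Proof.
  intros Hab HB Husc.
  set (E := fun l => exists u v, a <= u <= b /\ a <= v <= b /\ l = G u v).
  destruct (completeness E) as [S [HS1 HS2]].
  { exists B; intros l (u & v & Hu & Hv & ->); now apply HB. }
  { exists (G a a), a, a; repeat split; lra. }
  apply NNPP; intros Hno.
  assert (Hlt : forall u v, a <= u <= b -> a <= v <= b -> G u v < S).
  { intros u v Hu Hv.
    destruct (Rlt_or_le (G u v) S) as [H|H]; [exact H|exfalso].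
    apply Hno; exists u, v; split; [exact Hu|split; [exact Hv|]].
    intros x y Hx Hy; apply Rle_trans with S; [|exact H].
    apply HS1; exists x, y; auto. }
  assert (Hd : forall u v, exists d : posreal, a <= u <= b -> a <= v <= b ->
     d <= (S - G u v) / 2 /\
     forall x y, Rabs (x - u) < d -> Rabs (y - v) < d -> G x y < (S + G u v) / 2).
  { intros u v.
    destruct (classic ((a <= u <= b) /\ (a <= v <= b))) as [[Hu Hv]|Hn].
    - specialize (Hlt u v Hu Hv).
      destruct (Husc u v ((S + G u v) / 2) Hu Hv) as [d Hd]; [lra|].
      assert (Hp : 0 < Rmin d ((S - G u v) / 2)).
      { apply Rmin_glb_lt; [apply cond_pos|lra]. }
      exists (mkposreal _ Hp); intros _ _; simpl; split; [apply Rmin_r|].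
      intros x y Hx Hy; apply Hd; eapply Rlt_le_trans; eauto; apply Rmin_l.
    - exists (mkposreal 1 Rlt_0_1); intros Hu Hv; tauto. }
  pose (delta := fun u v => proj1_sig (constructive_indefinite_description _ (Hd u v))).
  assert (Hdelta : forall u v, a <= u <= b -> a <= v <= b ->
     delta u v <= (S - G u v) / 2 /\ forall x y, Rabs (x - u) < delta u v ->
       Rabs (y - v) < delta u v -> G x y < (S + G u v) / 2).
  { intros u v; exact (proj2_sig (constructive_indefinite_description _ (Hd u v))). }
  destruct (compactness_value_2d a b a b delta) as [d Hcov].
  assert (S <= S - d); [|generalize (cond_pos d); lra].
  apply HS2; intros l (x & y & Hx & Hy & ->).
  apply Rnot_lt_le; intros Hgt.
  apply (Hcov x y Hx Hy); intros (u & v & Hu & Hv & Hxu & Hyv & Hdd).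
  destruct (Hdelta u v Hu Hv) as [H1 H2].
  specialize (H2 x y Hxu Hyv); lra.
Qed.

(** Along [D], [F] tends to [-oo] at every point outside [D], so the function
    equal to [exp F] on [D] and to [0] elsewhere is upper semicontinuous on the whole square. *)
Lemma attains_max_on (D : R -> R -> Prop) (F : R -> R -> R) (B x0 y0 : R) :
  (forall x y, D x y -> -1 <= x <= 1 /\ -1 <= y <= 1) ->
  D x0 y0 ->
  (forall x y, D x y -> F x y <= B) ->
  (forall x y m, D x y -> F x y < m ->
     locally_2d (fun u v => D u v -> F u v < m) x y) ->
  (forall x y m, ~ D x y -> locally_2d (fun u v => D u v -> F u v < m) x y) ->
  exists u v, D u v /\ forall x y, D x y -> F x y <= F u v.
Proof.
  intros Hbox H0 HB Hin Hout.
  set (G := fun x y =>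
    if excluded_middle_informative (D x y) then exp (F x y) else 0).
  assert (GD : forall x y, D x y -> G x y = exp (F x y)).
  { intros x y H; unfold G; destruct excluded_middle_informative; tauto. }
  assert (GN : forall x y, ~ D x y -> G x y = 0).
  { intros x y H; unfold G; destruct excluded_middle_informative; tauto. }
  assert (Hlift : forall x y m, 0 < m ->
     locally_2d (fun u v => D u v -> F u v < ln m) x y ->
     locally_2d (fun u v => G u v < m) x y).
  { intros x y m Hm [d Hd]; exists d; intros u v Hu Hv.
    destruct (classic (D u v)) as [H|H].
    - rewrite (GD _ _ H), <- (exp_ln m Hm); apply exp_increasing; auto.
    - now rewrite (GN _ _ H). }
  destruct (usc_attains_max G (-1) 1 (exp B)) as (u & v & _ & _ & Hmax).
  - lra.
  - intros u v _ _; destruct (classic (D u v)) as [H|H].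
    + rewrite (GD _ _ H); destruct (HB _ _ H) as [H1|H1].
      * left; now apply exp_increasing.
      * right; now rewrite H1.
    + rewrite (GN _ _ H); left; apply exp_pos.
  - intros u v m _ _ Hm; destruct (classic (D u v)) as [H|H].
    + rewrite (GD _ _ H) in Hm.
      assert (0 < m) by (generalize (exp_pos (F u v)); lra).
      apply Hlift; auto; apply Hin; auto.
      apply exp_lt_inv; now rewrite exp_ln.
    + rewrite (GN _ _ H) in Hm; apply Hlift; auto.
  - exists u, v.
    assert (Huv : D u v).
    { apply NNPP; intros H.
      destruct (Hbox _ _ H0) as [Hx Hy].
      specialize (Hmax x0 y0 Hx Hy); rewrite (GD _ _ H0), (GN _ _ H) in Hmax.
      generalize (exp_pos (F x0 y0)); lra. }
    split; [exact Huv|]; intros x y H.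
    destruct (Hbox _ _ H) as [Hx Hy]; specialize (Hmax x y Hx Hy).
    rewrite (GD _ _ H), (GD _ _ Huv) in Hmax.
    apply Rnot_lt_le; intros Hlt; apply exp_increasing in Hlt; lra.
Qed.

(** * Pointwise Laplacians *)

(** Relational, with a first derivative required near [t] only: the functions
    of interest are not defined, or not regular, outside an open set. *)
Definition is_derive2 (g : R -> R) (t l : R) : Prop :=
  exists g' : R -> R, locally t (fun s => is_derive g s (g' s)) /\ is_derive g' t l.

(** The Euclidean Laplacian.  Continuity is included because the existence of
    second derivatives along the axes does not imply it. *)
Definition is_laplacian (F : R -> R -> R) (x y l : R) : Prop :=
  continuity_2d_pt F x y /\
  exists a b, is_derive2 (fun t => F t y) x a /\ is_derive2 (fun t => F x t) y b /\
    l = a + b.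

Lemma is_derive2_lin (c d : R) (f g : R -> R) (t a b : R) :
  is_derive2 f t a -> is_derive2 g t b ->
  is_derive2 (fun s => c * f s + d * g s) t (c * a + d * b).
Proof.
  assert (Hlin : forall (p q : R -> R) s p' q', is_derive p s p' -> is_derive q s q' ->
    is_derive (fun r => c * p r + d * q r) s (c * p' + d * q')).
  { intros p q s p' q' Hp Hq.
    apply (is_derive_plus (fun r => c * p r) (fun r => d * q r));
      now apply (is_derive_scal). }
  intros (f' & Hf & Hf2) (g' & Hg & Hg2).
  exists (fun s => c * f' s + d * g' s); split; [|now apply Hlin].
  generalize (filter_and _ _ Hf Hg); apply filter_imp.
  intros s [H1 H2]; now apply Hlin.
Qed.

Lemma is_derive2_ext_loc (f g : R -> R) (t l : R) :
  locally t (fun s => f s = g s) -> is_derive2 f t l -> is_derive2 g t l.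
Proof.
  intros He (f' & Hf & Hf2); exists f'; split; [|exact Hf2].
  generalize (filter_and _ _ (locally_locally _ _ He) Hf); apply filter_imp.
  intros s [H1 H2]; now apply (is_derive_ext_loc f).
Qed.

Lemma is_laplacian_lin (c d : R) (F G : R -> R -> R) (x y a b : R) :
  is_laplacian F x y a -> is_laplacian G x y b ->
  is_laplacian (fun u v => c * F u v + d * G u v) x y (c * a + d * b).
Proof.
  intros (HF & a1 & a2 & H1 & H2 & ->) (HG & b1 & b2 & H3 & H4 & ->); split.
  - apply continuity_2d_pt_plus; apply continuity_2d_pt_mult; auto;
      apply continuity_2d_pt_const.
  - exists (c * a1 + d * b1), (c * a2 + d * b2); split; [|split; [|ring]].
    + now apply (is_derive2_lin c d (fun t => F t y) (fun t => G t y)).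
    + now apply (is_derive2_lin c d (fun t => F x t) (fun t => G x t)).
Qed.

Lemma is_laplacian_ext_loc (F G : R -> R -> R) (x y l : R) :
  locally_2d (fun u v => F u v = G u v) x y ->
  is_laplacian F x y l -> is_laplacian G x y l.
Proof.
  intros He (HF & a & b & H1 & H2 & ->); split.
  - now apply (continuity_2d_pt_ext_loc F).
  - exists a, b; split; [|split; [|reflexivity]].
    + apply (is_derive2_ext_loc (fun t => F t y)); [|exact H1].
      exact (locally_2d_1d_const_y _ _ _ He).
    + apply (is_derive2_ext_loc (fun t => F x t)); [|exact H2].
      exact (locally_2d_1d_const_x _ _ _ He).
Qed.

Lemma is_laplacian_const (c x y : R) : is_laplacian (fun _ _ => c) x y 0.
Proof.
  assert (H : forall t, is_derive2 (fun _ => c) t 0).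
  { intros t; exists (fun _ => 0); split.
    - apply filter_forall; intros s; apply (is_derive_const c).
    - apply (is_derive_const 0). }
  split; [apply continuity_2d_pt_const|].
  exists 0, 0; split; [apply H|split; [apply H|ring]].
Qed.

(** At an interior maximum [g' t = 0]; if [l] were positive, [g'] would be
    positive just after [t] and the mean value theorem would make [g] exceed
    [g t] there. *)
Lemma is_derive2_max (g : R -> R) (t l : R) :
  locally t (fun s => g s <= g t) -> is_derive2 g t l -> l <= 0.
Proof.
  intros [d1 Hmax] (g' & [d2 Hg] & Hg2).
  assert (Hball : forall s (d : posreal), Rabs (s - t) < d -> ball t d s) by (intros; assumption).
  assert (Hcrit : g' t = 0).
  { assert (Ht : is_derive g t (g' t)).
    { apply Hg; apply ball_center. }
    apply is_derive_Reals in Ht.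
    rewrite <- (derive_pt_eq_0 _ _ _ (exist _ _ Ht) Ht).
    apply (deriv_maximum g (t - d1) (t + d1)).
    - generalize (cond_pos d1); lra.
    - generalize (cond_pos d1); lra.
    - intros x Hx1 Hx2; apply Hmax, Hball, Rabs_def1; lra. }
  apply Rnot_lt_le; intros Hl.
  apply is_derive_Reals in Hg2.
  destruct (Hg2 (l / 2)) as [d3 Hd3]; [lra|].
  assert (Hpos : forall s, t < s < t + d3 -> 0 < g' s).
  { intros s Hs; specialize (Hd3 (s - t)).
    rewrite Hcrit in Hd3; replace (t + (s - t)) with s in Hd3 by ring.
    assert (H : Rabs ((g' s - 0) / (s - t) - l) < l / 2).
    { apply Hd3; [lra|apply Rabs_def1; lra]. }
    apply Rabs_def2 in H.
    replace (g' s) with ((g' s - 0) / (s - t) * (s - t)) by (field; lra).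
    apply Rmult_lt_0_compat; lra. }
  set (r := Rmin d1 (Rmin d2 d3) / 2).
  assert (Hr : 0 < r < d1 /\ r < d2 /\ r < d3).
  { assert (0 < Rmin d1 (Rmin d2 d3)).
    { repeat apply Rmin_glb_lt; apply cond_pos. }
    generalize (Rmin_l d1 (Rmin d2 d3)) (Rmin_r d1 (Rmin d2 d3))
      (Rmin_l d2 d3) (Rmin_r d2 d3); unfold r; lra. }
  destruct (MVT_cor2 g g' t (t + r)) as (c & Hc & Hc2).
  - lra.
  - intros c Hc; apply is_derive_Reals, Hg, Hball, Rabs_def1; lra.
  - assert (g (t + r) <= g t) by (apply Hmax, Hball, Rabs_def1; lra).
    assert (0 < g' c * (t + r - t)) by (apply Rmult_lt_0_compat; [apply Hpos|]; lra).
    lra.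
Qed.

Lemma is_laplacian_max (F : R -> R -> R) (x y l : R) :
  locally_2d (fun u v => F u v <= F x y) x y -> is_laplacian F x y l -> l <= 0.
Proof.
  intros Hmax (_ & a & b & H1 & H2 & ->).
  apply is_derive2_max in H1; [|exact (locally_2d_1d_const_y _ _ _ Hmax)].
  apply is_derive2_max in H2; [|exact (locally_2d_1d_const_x _ _ _ Hmax)].
  lra.
Qed.

(** * The conformal factor *)

Lemma Cmod_sqr (x y : R) : Cmod (x, y) ^ 2 = x ^ 2 + y ^ 2.
Proof.
  unfold Cmod; simpl fst; simpl snd; rewrite pow2_sqrt; [ring|].
  apply Rplus_le_le_0_compat; apply pow2_ge_0.
Qed.

Lemma in_disc_sqr (x y : R) : in_disc (x, y) <-> x ^ 2 + y ^ 2 < 1.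
Proof.
  unfold in_disc; rewrite <- Cmod_sqr; generalize (Cmod_ge_0 (x, y)); split; intros; nra.
Qed.

Lemma continuity_2d_radius (x y : R) :
  continuity_2d_pt (fun u v => 1 - (u ^ 2 + v ^ 2)) x y.
Proof.
  apply continuity_2d_pt_minus; [apply continuity_2d_pt_const|].
  apply (continuity_2d_pt_ext (fun u v => u * u + v * v)); [intros; ring|].
  apply continuity_2d_pt_plus; apply continuity_2d_pt_mult;
    auto using continuity_2d_pt_id1, continuity_2d_pt_id2.
Qed.

Lemma continuity_2d_lt (F : R -> R -> R) (x y m : R) :
  continuity_2d_pt F x y -> F x y < m -> locally_2d (fun u v => F u v < m) x y.
Proof.
  intros HF Hm; assert (Hp : 0 < m - F x y) by lra.
  destruct (HF (mkposreal _ Hp)) as [d Hd]; exists d; intros u v Hu Hv.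
  specialize (Hd u v Hu Hv); simpl in Hd; apply Rabs_def2 in Hd; lra.
Qed.

Lemma continuity_2d_ln (F : R -> R -> R) (x y : R) :
  0 < F x y -> continuity_2d_pt F x y -> continuity_2d_pt (fun u v => ln (F u v)) x y.
Proof.
  intros Hp HF; apply (continuity_1d_2d_pt_comp ln F x y); [|exact HF].
  apply derivable_continuous_pt; exists (/ F x y); now apply derivable_pt_lim_ln.
Qed.

Lemma in_disc_locally (x y : R) :
  in_disc (x, y) -> locally_2d (fun u v => in_disc (u, v)) x y.
Proof.
  intros H; apply in_disc_sqr in H.
  destruct (continuity_2d_lt (fun u v => - (1 - (u ^ 2 + v ^ 2))) x y 0) as [d Hd].
  - apply continuity_2d_pt_opp, continuity_2d_radius.
  - lra.
  - exists d; intros u v Hu Hv; apply in_disc_sqr; specialize (Hd u v Hu Hv); lra.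
Qed.

Lemma sigma0_sqr (x y : R) : sigma0 (x, y) = 4 / (1 - (x ^ 2 + y ^ 2)) ^ 2.
Proof. unfold sigma0; now rewrite Cmod_sqr. Qed.

Lemma sigma0_pos (x y : R) : in_disc (x, y) -> 0 < sigma0 (x, y).
Proof.
  intros H; apply in_disc_sqr in H; rewrite sigma0_sqr.
  apply Rdiv_lt_0_compat; [lra|apply pow_lt; lra].
Qed.

Lemma is_derive2_ln_parabola (c t : R) :
  0 < 1 - (t ^ 2 + c) ->
  is_derive2 (fun s => ln (1 - (s ^ 2 + c))) t
    (- (2 * (1 - (t ^ 2 + c)) + 4 * t ^ 2) / (1 - (t ^ 2 + c)) ^ 2).
Proof.
  intros Hp; exists (fun s => - 2 * s / (1 - (s ^ 2 + c))); split.
  - assert (Hc : continuous (fun s => 1 - (s ^ 2 + c)) t).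
    { apply (ex_derive_continuous (fun s => 1 - (s ^ 2 + c))); auto_derive; auto. }
    generalize (Hc _ (open_gt 0 _ Hp)); unfold filtermap; apply filter_imp.
    intros s Hs; auto_derive; [lra|field; lra].
  - auto_derive; [lra|field; lra].
Qed.

(** This is the statement that [g0] has curvature [-1], since
    [ln sigma0 = ln 4 - 2 ln (1 - |z|^2)]. *)
Lemma is_laplacian_ln_radius (x y : R) :
  in_disc (x, y) ->
  is_laplacian (fun u v => ln (1 - (u ^ 2 + v ^ 2))) x y (- sigma0 (x, y)).
Proof.
  intros H; apply in_disc_sqr in H; split.
  - apply (continuity_2d_ln (fun u v => 1 - (u ^ 2 + v ^ 2))); [lra|].
    apply continuity_2d_radius.
  - do 2 eexists; split; [apply (is_derive2_ln_parabola (y ^ 2)); lra|split].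
    + apply (is_derive2_ext_loc (fun s => ln (1 - (s ^ 2 + x ^ 2)))).
      * apply filter_forall; intros s; f_equal; ring.
      * apply is_derive2_ln_parabola; lra.
    + rewrite sigma0_sqr; field; lra.
Qed.

Lemma is_derive2_Derive (g : R -> R) (t : R) :
  locally t (fun s => ex_derive g s) -> ex_derive (Derive g) t ->
  is_derive2 g t (Derive (Derive g) t).
Proof.
  intros H1 H2; exists (Derive g); split; [|now apply Derive_correct].
  revert H1; apply filter_imp; intros s; apply Derive_correct.
Qed.

(** In dimension two the trace [g^ij Gamma^k_ij] of a conformal metric
    vanishes, so only the factor [sigma0] separates the two Laplacians. *)
Lemma laplacian_g0 (h : C -> R) (x y : R) :
  Cn_on_disc 2 h -> in_disc (x, y) ->
  is_laplacian (fun u v => h (u, v)) x y (sigma0 (x, y) * laplacian g0 h (x, y)).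
Proof.
  intros Hh Hd; split; [apply (Hh x y Hd)|].
  exists (Derive (Derive (fun t => h (t, y))) x), (Derive (Derive (fun t => h (x, t))) y).
  assert (Hloc := in_disc_locally x y Hd).
  split; [|split].
  - apply is_derive2_Derive.
    + generalize (locally_2d_1d_const_y _ _ _ Hloc); apply filter_imp.
      intros s Hs; apply (Hh s y Hs).
    + apply (Hh x y Hd).
  - apply is_derive2_Derive.
    + generalize (locally_2d_1d_const_x _ _ _ Hloc); apply filter_imp.
      intros s Hs; apply (Hh x s Hs).
    + apply (Hh x y Hd).
  - generalize (sigma0_pos x y Hd); intros Hs.
    unfold laplacian, isum, christoffel, isum, inverse2, det2, partial.
    unfold g0, idx_eqb, other, fst, snd.
    rewrite !Derive_const.
    set (sx := Derive (fun t => sigma0 (t, y)) x).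
    set (sy := Derive (fun t => sigma0 (x, t)) y).
    change (Derive (fun t => Derive (fun t0 => h (t0, y)) t) x)
      with (Derive (Derive (fun t => h (t, y))) x).
    change (Derive (fun t => Derive (fun t0 => h (x, t0)) t) y)
      with (Derive (Derive (fun t => h (x, t))) y).
    field; lra.
Qed.

(** * Smoothness and logarithms of holomorphic functions *)

Lemma is_derive2_ln_norm (P Q P1 Q1 : R -> R) (t P2 Q2 : R) :
  0 < P t ^ 2 + Q t ^ 2 ->
  locally t (fun s => is_derive P s (P1 s)) -> locally t (fun s => is_derive Q s (Q1 s)) ->
  is_derive P1 t P2 -> is_derive Q1 t Q2 ->
  is_derive2 (fun s => ln (P s ^ 2 + Q s ^ 2)) t
    ((2 * (P1 t ^ 2 + P t * P2 + Q1 t ^ 2 + Q t * Q2) * (P t ^ 2 + Q t ^ 2)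
      - 4 * (P t * P1 t + Q t * Q1 t) ^ 2) / (P t ^ 2 + Q t ^ 2) ^ 2).
Proof.
  intros Hp HP HQ HP2 HQ2.
  assert (HPt := locally_singleton _ _ HP); assert (HQt := locally_singleton _ _ HQ).
  cbv beta in HPt, HQt.
  assert (Hex : forall (f : R -> R) s l, is_derive f s l -> ex_derive (fun r => f r) s)
    by (intros f s l H; exists l; exact H).
  assert (Hun : forall (f : R -> R) s l, is_derive f s l -> Derive (fun r => f r) s = l)
    by (intros f s l H; exact (is_derive_unique _ _ _ H)).
  exists (fun s => 2 * (P s * P1 s + Q s * Q1 s) / (P s ^ 2 + Q s ^ 2)); split.
  - assert (Hc : continuous (fun s => P s ^ 2 + Q s ^ 2) t).
    { apply (ex_derive_continuous (fun s => P s ^ 2 + Q s ^ 2)).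
      auto_derive; repeat split; eauto. }
    assert (Hpos : locally t (fun s => 0 < P s ^ 2 + Q s ^ 2)) by exact (Hc _ (open_gt 0 _ Hp)).
    generalize (filter_and _ _ Hpos (filter_and _ _ HP HQ)).
    apply filter_imp; intros s (Hs & HPs & HQs).
    auto_derive.
    + repeat split; eauto; simpl in Hs |- *; lra.
    + rewrite (Hun _ _ _ HPs), (Hun _ _ _ HQs).
      field; simpl in Hs |- *; lra.
  - auto_derive.
    + repeat split; eauto; simpl in Hp |- *; lra.
    + rewrite (Hun _ _ _ HPt), (Hun _ _ _ HQt).
      rewrite (Hun _ _ _ HP2), (Hun _ _ _ HQ2).
      field; simpl in Hp |- *; lra.
Qed.

Lemma is_derive_of_bound (g : R -> R) (t l : R) :
  (forall eps : posreal,
     locally t (fun s => Rabs (g s - g t - (s - t) * l) <= eps * Rabs (s - t))) ->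
  is_derive g t l.
Proof.
  intros H; apply is_derive_Reals; intros eps Heps.
  assert (Hp : 0 < eps / 2) by lra.
  destruct (H (mkposreal _ Hp)) as [d Hd]; simpl in Hd; exists d; intros h Hh0 Hh.
  specialize (Hd (t + h)).
  replace (t + h - t) with h in Hd by ring.
  assert (Hb : ball t d (t + h)).
  { change (Rabs (t + h - t) < d); now replace (t + h - t) with h by ring. }
  specialize (Hd Hb).
  replace ((g (t + h) - g t) / h - l) with ((g (t + h) - g t - h * l) / h) by (field; auto).
  assert (0 < Rabs h) by now apply Rabs_pos_lt.
  unfold Rdiv; rewrite Rabs_mult, Rabs_inv.
  apply (Rmult_lt_reg_r (Rabs h)); [assumption|].
  rewrite Rmult_assoc, Rinv_l by lra; nra.
Qed.

(** Complex differentiability as an estimate in the two real variables; the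
    filter of neighbourhoods of the normed module [C] over itself has to be
    exchanged for that of the product [R * R]. *)
Lemma is_derive_C_bound (f : C -> C) (x y : R) (l : C) :
  @is_derive C_AbsRing C_NormedModule f (x, y) l ->
  forall eps : posreal, locally_2d (fun u v =>
    Cmod (f (u, v) - f (x, y) - ((u, v) - (x, y)) * l)%C
      <= eps * Cmod ((u, v) - (x, y))%C) x y.
Proof.
  intros [_ H] eps; apply locally_2d_locally.
  assert (Hlim : is_filter_lim (@locally (AbsRing_UniformSpace C_AbsRing) (x, y)) (x, y))
    by (intros P HP; exact HP).
  specialize (H _ Hlim eps); apply locally_C in H.
  revert H; apply filter_imp; intros [u v] H; exact H.
Qed.

Lemma cauchy_riemann (f : C -> C) (x y : R) :
  @ex_derive C_AbsRing C_NormedModule f (x, y) ->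
  Derive (fun t => Re (f (t, y))) x = Derive (fun t => Im (f (x, t))) y /\
  Derive (fun t => Re (f (x, t))) y = - Derive (fun t => Im (f (t, y))) x.
Proof.
  intros [[p q] H]; assert (Hb := is_derive_C_bound f x y (p, q) H).
  assert (Hre : forall c, Rabs (Re c) <= Cmod c).
  { intros c; apply Rle_trans with (2 := Rmax_Cmod c); apply Rmax_l. }
  assert (Him : forall c, Rabs (Im c) <= Cmod c).
  { intros c; apply Rle_trans with (2 := Rmax_Cmod c); apply Rmax_r. }
  assert (Hh : forall t, Cmod ((t, y) - (x, y))%C = Rabs (t - x)).
  { intros t; replace ((t, y) - (x, y))%C with (RtoC (t - x)).
    - apply Cmod_R.
    - unfold Cminus, Cplus, Copp, RtoC; simpl; f_equal; ring. }
  assert (Hv : forall t, Cmod ((x, t) - (x, y))%C = Rabs (t - y)).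
  { intros t; replace ((x, t) - (x, y))%C with (Ci * RtoC (t - y))%C.
    - rewrite Cmod_mult, Cmod_R; unfold Cmod, Ci; simpl.
      replace (0 * (0 * 1) + 1 * (1 * 1)) with 1 by ring; rewrite sqrt_1; ring.
    - unfold Cminus, Cplus, Copp, RtoC, Cmult, Ci; simpl; f_equal; ring. }
  assert (Hx : forall eps : posreal, locally x (fun t =>
    Cmod (f (t, y) - f (x, y) - ((t, y) - (x, y)) * (p, q))%C <= eps * Rabs (t - x))).
  { intros eps; generalize (locally_2d_1d_const_y _ _ _ (Hb eps)); apply filter_imp.
    intros t; now rewrite Hh. }
  assert (Hy : forall eps : posreal, locally y (fun t =>
    Cmod (f (x, t) - f (x, y) - ((x, t) - (x, y)) * (p, q))%C <= eps * Rabs (t - y))).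
  { intros eps; generalize (locally_2d_1d_const_x _ _ _ (Hb eps)); apply filter_imp.
    intros t; now rewrite Hv. }
  assert (H1 : is_derive (fun t => Re (f (t, y))) x p).
  { apply is_derive_of_bound; intros eps; generalize (Hx eps); apply filter_imp.
    intros t Ht; apply Rle_trans with (2 := Ht); apply Rle_trans with (2 := Hre _).
    right; f_equal; simpl; unfold Re; ring. }
  assert (H2 : is_derive (fun t => Im (f (t, y))) x q).
  { apply is_derive_of_bound; intros eps; generalize (Hx eps); apply filter_imp.
    intros t Ht; apply Rle_trans with (2 := Ht); apply Rle_trans with (2 := Him _).
    right; f_equal; simpl; unfold Im; ring. }
  assert (H3 : is_derive (fun t => Re (f (x, t))) y (- q)).
  { apply is_derive_of_bound; intros eps; generalize (Hy eps); apply filter_imp.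
    intros t Ht; apply Rle_trans with (2 := Ht); apply Rle_trans with (2 := Hre _).
    right; f_equal; simpl; unfold Re; ring. }
  assert (H4 : is_derive (fun t => Im (f (x, t))) y p).
  { apply is_derive_of_bound; intros eps; generalize (Hy eps); apply filter_imp.
    intros t Ht; apply Rle_trans with (2 := Ht); apply Rle_trans with (2 := Him _).
    right; f_equal; simpl; unfold Im; ring. }
  split.
  - exact (eq_trans (is_derive_unique _ _ _ H1) (eq_sym (is_derive_unique _ _ _ H4))).
  - exact (eq_trans (is_derive_unique _ _ _ H3)
      (eq_sym (f_equal Ropp (is_derive_unique _ _ _ H2)))).
Qed.

Lemma Cn_on_disc_ext (n : nat) (f g : C -> R) :
  (forall z, in_disc z -> f z = g z) -> Cn_on_disc n f -> Cn_on_disc n g.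
Proof.
  intros He Hf x y Hd; apply (ex_diff_n_ext_loc (fun a b => f (a, b))); [|now apply Hf].
  destruct (in_disc_locally x y Hd) as [d Hl]; exists d; auto.
Qed.

Lemma Cn_on_disc_lin (n : nat) (c d : R) (f g : C -> R) :
  Cn_on_disc n f -> Cn_on_disc n g -> Cn_on_disc n (fun z => c * f z + d * g z).
Proof.
  assert (Hex : forall (k r : R -> R) s, ex_derive k s -> ex_derive r s ->
    is_derive (fun t => c * k t + d * r t) s (c * Derive k s + d * Derive r s)).
  { intros k r s Hk Hr.
    apply (is_derive_plus (fun t => c * k t) (fun t => d * r t));
      apply is_derive_scal; now apply Derive_correct. }
  revert f g; induction n as [|n IH]; intros f g Hf Hg x y Hd;
    assert (Hfd := Hf x y Hd); assert (Hgd := Hg x y Hd);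
    (split; [apply continuity_2d_pt_plus; apply continuity_2d_pt_mult;
      try apply continuity_2d_pt_const; [apply Hfd|apply Hgd]|]); [exact I|].
  destruct (in_disc_locally x y Hd) as [e He].
  split; [|split; [|split]].
  - eexists; apply (Hex (fun t => f (t, y)) (fun t => g (t, y))); [apply Hfd|apply Hgd].
  - eexists; apply (Hex (fun t => f (x, t)) (fun t => g (x, t))); [apply Hfd|apply Hgd].
  - apply (ex_diff_n_ext_loc
      (fun u v => c * partial I1 f (u, v) + d * partial I1 g (u, v))).
    + exists e; intros u v Hu Hv; specialize (He u v Hu Hv); symmetry.
      apply is_derive_unique, (Hex (fun t => f (t, v)) (fun t => g (t, v)));
        [apply (Hf u v He)|apply (Hg u v He)].
    + apply (IH (partial I1 f) (partial I1 g)); [| |exact Hd];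
        intros u v Huv; [apply (Hf u v Huv)|apply (Hg u v Huv)].
  - apply (ex_diff_n_ext_loc
      (fun u v => c * partial I2 f (u, v) + d * partial I2 g (u, v))).
    + exists e; intros u v Hu Hv; specialize (He u v Hu Hv); symmetry.
      apply is_derive_unique, (Hex (fun t => f (u, t)) (fun t => g (u, t)));
        [apply (Hf u v He)|apply (Hg u v He)].
    + apply (IH (partial I2 f) (partial I2 g)); [| |exact Hd];
        intros u v Huv; [apply (Hf u v Huv)|apply (Hg u v Huv)].
Qed.

(** Evaluating [g = phi + e g0 + conj phi] on the vectors [1], [i] and [1 + i]
    gives [4 Re phi = g_11 - g_22] and [4 Im phi = - (g_12 + g_21)]: the
    coefficient of a Hopf differential is as regular as the metric. *)
Lemma hopf_coefficient_smooth (n : nat) (g : tensor2) (phi : C -> C) :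
  has_hopf_differential g phi -> (forall i j, Cn_on_disc n (g i j)) ->
  Cn_on_disc n (fun z => Re (phi z)) /\ Cn_on_disc n (fun z => Im (phi z)).
Proof.
  intros [e He] Hg; split.
  - apply (Cn_on_disc_ext n (fun z => / 4 * g I1 I1 z + - / 4 * g I2 I2 z)).
    + intros z Hz.
      generalize (He z (1, 0) Hz) (He z (0, 1) Hz).
      unfold quad, re2, g0, isum, coord, Cmult, Re; simpl; lra.
    + now apply Cn_on_disc_lin.
  - apply (Cn_on_disc_ext n (fun z => - / 4 * g I1 I2 z + - / 4 * g I2 I1 z)).
    + intros z Hz.
      generalize (He z (1, 0) Hz) (He z (0, 1) Hz) (He z (1, 1) Hz).
      unfold quad, re2, g0, isum, coord, Cmult, Re, Im; simpl; lra.
    + now apply Cn_on_disc_lin.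
Qed.

(** [ln |f|] is harmonic where [f = P + i Q] does not vanish.  Schwarz's theorem
    turns the Cauchy-Riemann equations into [P_xx = - P_yy] and
    [Q_yy = - Q_xx]; the first order terms cancel because the gradients of [P]
    and [Q] are orthogonal and of equal length. *)
Lemma is_laplacian_ln_norm (P Q : C -> R) (x y : R) :
  Cn_on_disc 2 P -> Cn_on_disc 2 Q ->
  (forall u v, in_disc (u, v) ->
     Derive (fun t => P (t, v)) u = Derive (fun t => Q (u, t)) v /\
     Derive (fun t => P (u, t)) v = - Derive (fun t => Q (t, v)) u) ->
  in_disc (x, y) -> 0 < P (x, y) ^ 2 + Q (x, y) ^ 2 ->
  is_laplacian (fun u v => ln (P (u, v) ^ 2 + Q (u, v) ^ 2)) x y 0.
Proof.
  intros HP HQ HCR Hd Hpos.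
  assert (Hloc := in_disc_locally x y Hd).
  assert (HPd := HP x y Hd); assert (HQd := HQ x y Hd).
  split.
  { apply (continuity_2d_ln (fun u v => P (u, v) ^ 2 + Q (u, v) ^ 2)); [exact Hpos|].
    apply (continuity_2d_pt_ext (fun u v => P (u, v) * P (u, v) + Q (u, v) * Q (u, v)));
      [intros; ring|].
    apply continuity_2d_pt_plus; apply continuity_2d_pt_mult;
      first [apply HPd|apply HQd]. }
  assert (Hschwarz : forall p : C -> R, Cn_on_disc 2 p ->
    Derive (fun s => Derive (fun t => p (s, t)) y) x =
    Derive (fun s => Derive (fun t => p (t, s)) x) y).
  { intros p Hp; apply (Schwarz (fun u v => p (u, v))); [|apply (Hp x y Hd)..].
    destruct Hloc as [e He]; exists e; intros u v Hu Hv.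
    specialize (Hp u v (He u v Hu Hv)); repeat split; apply Hp. }
  set (Pxx := Derive (fun s => Derive (fun t => P (t, y)) s) x).
  set (Qxx := Derive (fun s => Derive (fun t => Q (t, y)) s) x).
  set (Pyy := Derive (fun s => Derive (fun t => P (x, t)) s) y).
  set (Qyy := Derive (fun s => Derive (fun t => Q (x, t)) s) y).
  assert (HPl : Pxx = - Pyy).
  { transitivity (Derive (fun s => Derive (fun t => Q (s, t)) y) x).
    - apply Derive_ext_loc.
      generalize (locally_2d_1d_const_y _ _ _ Hloc); apply filter_imp.
      intros s Hs; apply (HCR s y Hs).
    - rewrite (Hschwarz Q HQ); unfold Pyy; rewrite <- Derive_opp.
      apply Derive_ext_loc.
      generalize (locally_2d_1d_const_x _ _ _ Hloc); apply filter_imp.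
      intros s Hs; destruct (HCR x s Hs) as [_ ->]; ring. }
  assert (HQl : Qyy = - Qxx).
  { transitivity (Derive (fun s => Derive (fun t => P (t, s)) x) y).
    - apply Derive_ext_loc.
      generalize (locally_2d_1d_const_x _ _ _ Hloc); apply filter_imp.
      intros s Hs; symmetry; apply (HCR x s Hs).
    - rewrite <- (Hschwarz P HP); unfold Qxx; rewrite <- Derive_opp.
      apply Derive_ext_loc.
      generalize (locally_2d_1d_const_y _ _ _ Hloc); apply filter_imp.
      intros s Hs; destruct (HCR s y Hs) as [_ ->]; ring. }
  do 2 eexists; split; [|split].
  - apply (is_derive2_ln_norm (fun t => P (t, y)) (fun t => Q (t, y))
      (Derive (fun t => P (t, y))) (Derive (fun t => Q (t, y))) x Pxx Qxx Hpos).
    + generalize (locally_2d_1d_const_y _ _ _ Hloc); apply filter_imp.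
      intros s Hs; apply Derive_correct, (HP s y Hs).
    + generalize (locally_2d_1d_const_y _ _ _ Hloc); apply filter_imp.
      intros s Hs; apply Derive_correct, (HQ s y Hs).
    + apply Derive_correct, HPd.
    + apply Derive_correct, HQd.
  - apply (is_derive2_ln_norm (fun t => P (x, t)) (fun t => Q (x, t))
      (Derive (fun t => P (x, t))) (Derive (fun t => Q (x, t))) y Pyy Qyy Hpos).
    + generalize (locally_2d_1d_const_x _ _ _ Hloc); apply filter_imp.
      intros s Hs; apply Derive_correct, (HP x s Hs).
    + generalize (locally_2d_1d_const_x _ _ _ Hloc); apply filter_imp.
      intros s Hs; apply Derive_correct, (HQ x s Hs).
    + apply Derive_correct, HPd.
    + apply Derive_correct, HQd.
  - destruct (HCR x y Hd) as [-> ->]; rewrite HPl, HQl.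
    field; lra.
Qed.

(** * The norm of a quadratic differential *)

Definition regular_at (phi : C -> C) (x y : R) : Prop :=
  in_disc (x, y) /\ phi (x, y) <> RtoC 0.

(** The definition of holomorphy only gives first derivatives; the second ones
    come from the metric, by [hopf_coefficient_smooth]. *)
Definition smooth_bounded_hqd (phi : C -> C) : Prop :=
  bounded_hqd phi /\
  Cn_on_disc 2 (fun z => Re (phi z)) /\ Cn_on_disc 2 (fun z => Im (phi z)).

Definition norm_sqr (phi : C -> C) (x y : R) : R :=
  Re (phi (x, y)) ^ 2 + Im (phi (x, y)) ^ 2.

Lemma norm_sqr_Cmod (phi : C -> C) (x y : R) :
  norm_sqr phi x y = Cmod (phi (x, y)) ^ 2.
Proof. unfold norm_sqr; destruct (phi (x, y)); simpl Re; simpl Im; now rewrite Cmod_sqr. Qed.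

Lemma norm_sqr_pos (phi : C -> C) (x y : R) :
  phi (x, y) <> RtoC 0 -> 0 < norm_sqr phi x y.
Proof. intros H; rewrite norm_sqr_Cmod; apply pow_lt; now apply Cmod_gt_0. Qed.

Lemma qd_norm_pos (phi : C -> C) (x y : R) :
  regular_at phi x y -> 0 < qd_norm phi (x, y).
Proof.
  intros [Hd H]; apply Rdiv_lt_0_compat; [now apply Cmod_gt_0|now apply sigma0_pos].
Qed.

Lemma continuity_2d_norm_sqr (phi : C -> C) (x y : R) :
  smooth_bounded_hqd phi -> in_disc (x, y) -> continuity_2d_pt (norm_sqr phi) x y.
Proof.
  intros (_ & HP & HQ) Hd.
  apply (continuity_2d_pt_ext (fun u v => Re (phi (u, v)) * Re (phi (u, v))
    + Im (phi (u, v)) * Im (phi (u, v)))); [intros; unfold norm_sqr; ring|].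
  apply continuity_2d_pt_plus; apply continuity_2d_pt_mult;
    first [apply (HP x y Hd)|apply (HQ x y Hd)].
Qed.

Lemma regular_locally (phi : C -> C) (x y : R) :
  smooth_bounded_hqd phi -> regular_at phi x y -> locally_2d (regular_at phi) x y.
Proof.
  intros Hphi [Hd H].
  assert (Hnz : locally_2d (fun u v => norm_sqr phi u v <> 0) x y).
  { apply continuity_2d_pt_neq_0; [now apply continuity_2d_norm_sqr|].
    generalize (norm_sqr_pos phi x y H); lra. }
  generalize (locally_2d_and _ _ _ _ (in_disc_locally x y Hd) Hnz); apply locally_2d_impl.
  apply locally_2d_forall; intros u v [Hu Hn]; split; [exact Hu|].
  intros H0; apply Hn; rewrite norm_sqr_Cmod, H0, Cmod_0; ring.
Qed.

Lemma ln_qd_norm (phi : C -> C) (x y : R) :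
  regular_at phi x y ->
  ln (qd_norm phi (x, y)) =
    / 2 * ln (norm_sqr phi x y) + (2 * ln (1 - (x ^ 2 + y ^ 2)) - ln 4).
Proof.
  intros [Hd H]; assert (Hr := proj1 (in_disc_sqr x y) Hd).
  assert (Hc := proj1 (Cmod_gt_0 _) H).
  rewrite norm_sqr_Cmod; unfold qd_norm; rewrite sigma0_sqr.
  set (s := 1 - (x ^ 2 + y ^ 2)) in *.
  assert (Hs : 0 < s) by (unfold s; lra).
  replace (Cmod (phi (x, y)) / (4 / s ^ 2)) with (Cmod (phi (x, y)) * (s * s * / 4))
    by (field; lra).
  replace (Cmod (phi (x, y)) ^ 2) with (Cmod (phi (x, y)) * Cmod (phi (x, y))) by ring.
  assert (0 < s * s) by nra.
  rewrite (ln_mult _ (s * s * / 4)), (ln_mult (s * s)), !ln_mult, ln_Rinv; lra.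
Qed.

(** In terms of the Laplacian of [g0] the value is [-2]. *)
Lemma is_laplacian_ln_qd_norm (phi : C -> C) (x y : R) :
  smooth_bounded_hqd phi -> regular_at phi x y ->
  is_laplacian (fun u v => ln (qd_norm phi (u, v))) x y (- 2 * sigma0 (x, y)).
Proof.
  intros Hphi Hreg; assert (Hloc := regular_locally phi x y Hphi Hreg).
  destruct Hphi as ([Hhol _] & HP & HQ); destruct Hreg as [Hd H].
  apply (is_laplacian_ext_loc (fun u v => / 2 * ln (norm_sqr phi u v)
    + 1 * (2 * ln (1 - (u ^ 2 + v ^ 2)) + - 1 * ln 4))).
  - revert Hloc; apply locally_2d_impl, locally_2d_forall; intros u v Huv.
    rewrite (ln_qd_norm phi u v Huv); ring.
  - replace (- 2 * sigma0 (x, y))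
      with (/ 2 * 0 + 1 * (2 * - sigma0 (x, y) + - 1 * 0)) by ring.
    apply is_laplacian_lin.
    + apply (is_laplacian_ln_norm (fun z => Re (phi z)) (fun z => Im (phi z)));
        auto using norm_sqr_pos.
      * intros u v Huv; apply cauchy_riemann, Hhol, Huv.
      * now apply norm_sqr_pos.
    + apply is_laplacian_lin; [now apply is_laplacian_ln_radius|apply is_laplacian_const].
Qed.

Lemma ln_le_0 (s : R) : 0 < s <= 1 -> ln s <= 0.
Proof. intros H; rewrite <- ln_1; apply ln_le; lra. Qed.

Lemma ln_qd_norm_bounded (phi : C -> C) :
  bounded_hqd phi ->
  exists A, forall x y, regular_at phi x y -> ln (qd_norm phi (x, y)) <= A.
Proof.
  intros [_ [M HM]]; exists (ln M); intros x y Hreg.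
  apply ln_le; [now apply qd_norm_pos|apply HM, Hreg].
Qed.

(** The first term takes care of the zeros of [phi] and the second of the unit
    circle; at each of these places the other term is bounded above. *)
Lemma exhaustion_tends_to_minus_infinity (phi : C -> C) (x y m : R) :
  smooth_bounded_hqd phi -> ~ regular_at phi x y ->
  locally_2d (fun u v => regular_at phi u v ->
    ln (qd_norm phi (u, v)) + ln (1 - (u ^ 2 + v ^ 2)) < m) x y.
Proof.
  intros Hphi Hn.
  assert (Hln : forall s r, 0 < s -> s < exp r -> ln s < r).
  { intros s r Hs Hr; rewrite <- (ln_exp r); now apply ln_increasing. }
  destruct (classic (in_disc (x, y))) as [Hd|Hd].
  - assert (Hz : phi (x, y) = RtoC 0) by (apply NNPP; intros H; apply Hn; now split).
    assert (Hsmall : locally_2d (fun u v => norm_sqr phi u v < exp (2 * m)) x y).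
    { apply continuity_2d_lt; [now apply continuity_2d_norm_sqr|].
      rewrite norm_sqr_Cmod, Hz, Cmod_0; generalize (exp_pos (2 * m)); lra. }
    revert Hsmall; apply locally_2d_impl, locally_2d_forall; intros u v Hs Huv.
    rewrite (ln_qd_norm phi u v Huv).
    destruct Huv as [Hd' H']; assert (Hr := proj1 (in_disc_sqr u v) Hd').
    assert (Hl := Hln _ _ (norm_sqr_pos phi u v H') Hs).
    assert (ln (1 - (u ^ 2 + v ^ 2)) <= 0) by (apply ln_le_0; nra).
    assert (0 < ln 4) by (rewrite <- ln_1; apply ln_increasing; lra).
    lra.
  - destruct (ln_qd_norm_bounded phi (proj1 Hphi)) as [A HA].
    rewrite in_disc_sqr in Hd.
    assert (Hsmall : locally_2d (fun u v => 1 - (u ^ 2 + v ^ 2) < exp (m - A)) x y).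
    { apply (continuity_2d_lt (fun u v => 1 - (u ^ 2 + v ^ 2))).
      - apply continuity_2d_radius.
      - generalize (exp_pos (m - A)); lra. }
    revert Hsmall; apply locally_2d_impl, locally_2d_forall; intros u v Hs Huv.
    assert (Hr := proj1 (in_disc_sqr u v) (proj1 Huv)).
    specialize (HA u v Huv); apply Hln in Hs; lra.
Qed.

(** * The maximum principle *)

(** Suppose [w0 = w (x0, y0) > 0], and maximise [F = w + eps q], where
    [q = ln |phi| + ln (1 - |z|^2)] has Laplacian [-3 sigma0] and tends to [-oo]
    at the zeros of [phi] and at the unit circle.  At a maximum
    [w >= w0 - eps (A - q (x0, y0))], where [A] bounds [q], and
    [c sigma0 w <= L <= 3 eps sigma0]; for small [eps] these are
    contradictory. *)
Lemma maximum_principle (phi : C -> C) (w L : R -> R -> R) (B c : R) :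
  smooth_bounded_hqd phi -> 0 < c ->
  (forall x y, regular_at phi x y -> w x y <= B) ->
  (forall x y, regular_at phi x y -> is_laplacian w x y (L x y)) ->
  (forall x y, regular_at phi x y -> 0 < w x y -> c * sigma0 (x, y) * w x y <= L x y) ->
  forall x y, regular_at phi x y -> w x y <= 0.
Proof.
  intros Hphi Hc HB HL Hsub x0 y0 H0.
  apply Rnot_lt_le; intros Hw0.
  destruct (ln_qd_norm_bounded phi (proj1 Hphi)) as [A HA].
  set (q := fun u v => 1 * ln (qd_norm phi (u, v)) + 1 * ln (1 - (u ^ 2 + v ^ 2))).
  assert (HqA : forall u v, regular_at phi u v -> q u v <= A).
  { intros u v Huv; generalize (HA u v Huv); unfold q.
    assert (Hr := proj1 (in_disc_sqr u v) (proj1 Huv)).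
    assert (ln (1 - (u ^ 2 + v ^ 2)) <= 0) by (apply ln_le_0; nra).
    lra. }
  assert (Hq : forall u v, regular_at phi u v ->
    is_laplacian q u v (1 * (- 2 * sigma0 (u, v)) + 1 * - sigma0 (u, v))).
  { intros u v Huv; apply is_laplacian_lin.
    - now apply is_laplacian_ln_qd_norm.
    - now apply is_laplacian_ln_radius, Huv. }
  (* With [eps = w0 / (2 k)], the terms [A - q x0 y0] and [3 / c] of [k] ensure
     [eps * (A - q x0 y0) < w0 / 2] and [3 * eps < c * w0 / 2]. *)
  set (k := A - q x0 y0 + 3 / c + 1).
  assert (Hgap := HqA x0 y0 H0).
  assert (H3c : 0 < 3 / c) by (apply Rdiv_lt_0_compat; lra).
  assert (Hk : 0 < k) by (unfold k; lra).
  set (eps := w x0 y0 / (2 * k)).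
  assert (Heps : 0 < eps) by (apply Rdiv_lt_0_compat; lra).
  assert (Hw0k : w x0 y0 = 2 * eps * k) by (unfold eps; field; lra).
  assert (Hck : 3 < c * k).
  { replace 3 with (c * (3 / c)) by (field; lra).
    apply Rmult_lt_compat_l; [exact Hc|unfold k; lra]. }
  set (F := fun u v => 1 * w u v + eps * q u v).
  assert (HF : forall u v, regular_at phi u v -> is_laplacian F u v
    (1 * L u v + eps * (1 * (- 2 * sigma0 (u, v)) + 1 * - sigma0 (u, v)))).
  { intros u v Huv; apply is_laplacian_lin; auto. }
  destruct (attains_max_on (regular_at phi) F (B + eps * A) x0 y0) as (u & v & Huv & Hmax).
  - intros x y Hreg; assert (Hr := proj1 (in_disc_sqr x y) (proj1 Hreg)); nra.
  - exact H0.
  - intros x y Hreg; unfold F.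
    generalize (HB x y Hreg) (HqA x y Hreg); nra.
  - intros x y m Hreg Hm; destruct (HF x y Hreg) as [Hcont _].
    generalize (continuity_2d_lt F x y m Hcont Hm).
    apply locally_2d_impl, locally_2d_forall; auto.
  - intros x y m Hreg.
    generalize (exhaustion_tends_to_minus_infinity phi x y ((m - B) / eps) Hphi Hreg).
    apply locally_2d_impl, locally_2d_forall; intros u v H Huv; specialize (H Huv).
    assert (Hqm : eps * q u v < m - B).
    { replace (m - B) with (eps * ((m - B) / eps)) by (field; lra).
      apply Rmult_lt_compat_l; [exact Heps|unfold q; lra]. }
    generalize (HB u v Huv); unfold F; lra.
  - assert (Hlap := HF u v Huv); apply is_laplacian_max in Hlap.
    2: { generalize (regular_locally phi u v Hphi Huv).
         apply locally_2d_impl, locally_2d_forall; auto. }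
    assert (Hs := sigma0_pos u v (proj1 Huv)).
    assert (Hw : eps * k <= w u v).
    { generalize (Hmax x0 y0 H0) (HqA u v Huv); unfold F, k in *; nra. }
    assert (Hwp : 0 < w u v) by nra.
    specialize (Hsub u v Huv Hwp).
    assert (c * sigma0 (u, v) * (eps * k) <= c * sigma0 (u, v) * w u v).
    { apply Rmult_le_compat_l; [nra|exact Hw]. }
    assert (0 < (c * k - 3) * (sigma0 (u, v) * eps)) by (apply Rmult_lt_0_compat; nra).
    lra.
Qed.

(** * Comparison of distortion factors *)

(** With [e^a = |phi1|] and [e^b = |phi2|], the right-hand side is
    [2 |phi1| sinh (u + w) - 2 |phi2| sinh u].  Since [u + w >= 0], lowering [a]
    to [b] decreases it, and [2 (sinh (u + w) - sinh u) >= e^u (e^w - 1)]. *)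
Lemma sinh_gap (a b u w : R) :
  b <= a -> 0 <= u -> 0 <= w ->
  exp (b + u) * w <=
    (exp (a + (u + w)) - exp (a - (u + w))) - (exp (b + u) - exp (b - u)).
Proof.
  intros Hab Hu Hw; unfold Rminus; rewrite !exp_plus.
  assert (Hexp : forall s t, s <= t -> exp s <= exp t).
  { intros s t [H| ->]; [left; now apply exp_increasing|right; reflexivity]. }
  assert (H1 := Hexp _ _ Hab); assert (H2 := exp_pos a); assert (H3 := exp_pos b).
  assert (H4 : exp (- (u + w)) <= exp (- u)) by (apply Hexp; lra).
  assert (H5 : exp (- u) <= exp u) by (apply Hexp; lra).
  assert (H6 := exp_ineq1_le w); assert (H7 := exp_pos u).
  assert (exp u * w <= exp u * exp w - exp u) by nra.
  assert (exp b * (exp u * w) <= exp b * (exp u * exp w - exp u)) by nra.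
  assert (0 <= (exp a - exp b) * (exp u * exp w - exp (- (u + w)))).
  { apply Rmult_le_pos; nra. }
  assert (0 <= exp b * (exp (- u) - exp (- (u + w)))) by (apply Rmult_le_pos; lra).
  lra.
Qed.

(** The equation for [h] in the Euclidean coordinates, with [|phi|^2 e^(-h)]
    written as [e^(2 ln |phi| - h)]. *)
Lemma laplacian_solution (phi : C -> C) (h : C -> R) (x y : R) :
  bounded_solution phi h -> regular_at phi x y ->
  is_laplacian (fun u v => h (u, v)) x y
    (2 * sigma0 (x, y) * (exp (h (x, y))
      - exp (2 * ln (qd_norm phi (x, y)) - h (x, y)) - 1)).
Proof.
  intros (Hh & _ & Heq) Hreg; assert (Hd := proj1 Hreg).
  specialize (Heq _ Hd); generalize (laplacian_g0 h x y Hh Hd).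
  replace (exp (2 * ln (qd_norm phi (x, y)) - h (x, y)))
    with (qd_norm phi (x, y) ^ 2 * exp (- h (x, y))).
  - match goal with |- is_laplacian _ _ _ ?l -> is_laplacian _ _ _ ?l' =>
      replace l' with l; [trivial|] end.
    rewrite Rmult_assoc, <- Rmult_assoc, (Rmult_comm 2), Rmult_assoc.
    f_equal; lra.
  - unfold Rminus; rewrite exp_plus, <- (exp_ln (qd_norm phi (x, y))) at 1
      by now apply qd_norm_pos.
    f_equal; replace (2 * ln (qd_norm phi (x, y)))
      with (ln (qd_norm phi (x, y)) + ln (qd_norm phi (x, y))) by ring.
    rewrite exp_plus; ring.
Qed.

(** Where [w = ln |phi| - h] is positive, its hyperbolic Laplacian is
    [2 e^h (e^(2 w) - 1)], at least a positive multiple of [w] because [h] is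
    bounded below. *)
Lemma distortion_nonneg (phi : C -> C) (h : C -> R) :
  smooth_bounded_hqd phi -> bounded_solution phi h ->
  forall x y, regular_at phi x y -> ln (qd_norm phi (x, y)) <= h (x, y).
Proof.
  intros Hphi Hsol x y Hreg.
  destruct (ln_qd_norm_bounded phi (proj1 Hphi)) as [A HA].
  destruct (proj1 (proj2 Hsol)) as [B HB].
  assert (Hh : forall u v, regular_at phi u v -> - B <= h (u, v)).
  { intros u v Huv; generalize (Rcomplements.Rabs_le_between (h (u, v)) B).
    intros [H _]; apply H, HB, Huv. }
  enough (1 * ln (qd_norm phi (x, y)) + - 1 * h (x, y) <= 0) by lra.
  revert x y Hreg.
  apply (maximum_principle phi _ (fun u v => 1 * (- 2 * sigma0 (u, v)) + - 1 *
    (2 * sigma0 (u, v) * (exp (h (u, v))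
      - exp (2 * ln (qd_norm phi (u, v)) - h (u, v)) - 1))) (A + B) (exp (- B)) Hphi).
  - apply exp_pos.
  - intros u v Huv; generalize (HA u v Huv) (Hh u v Huv); lra.
  - intros u v Huv; apply is_laplacian_lin;
      [now apply is_laplacian_ln_qd_norm|now apply laplacian_solution].
  - intros u v Huv Hpos.
    assert (Hs := sigma0_pos u v (proj1 Huv)).
    set (w := 1 * ln (qd_norm phi (u, v)) + - 1 * h (u, v)) in *.
    replace (2 * ln (qd_norm phi (u, v)) - h (u, v)) with (h (u, v) + 2 * w)
      by (unfold w; ring).
    rewrite exp_plus.
    assert (H1 := exp_ineq1_le (2 * w)).
    assert (H2 : exp (- B) <= exp (h (u, v))).
    { destruct (Hh u v Huv) as [H| <-]; [left; now apply exp_increasing|right; reflexivity]. }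
    assert (H3 := exp_pos (- B)).
    assert (H4 : exp (- B) * w <= 2 * (exp (h (u, v)) * (exp (2 * w) - 1))) by nra.
    apply (Rmult_le_compat_l (sigma0 (u, v))) in H4; [lra|lra].
Qed.

(** [w = u1 - u2] satisfies the hypotheses of the maximum principle off the
    zeros of [phi2]: it is at most [h1 - h2], and [sinh_gap] bounds its
    Laplacian below, thanks to [u2 >= 0]. *)
Lemma distortion_comparison (phi1 phi2 : C -> C) (h1 h2 : C -> R) :
  smooth_bounded_hqd phi1 -> smooth_bounded_hqd phi2 ->
  bounded_solution phi1 h1 -> bounded_solution phi2 h2 ->
  (forall x y, regular_at phi2 x y -> regular_at phi1 x y) ->
  (forall x y, in_disc (x, y) -> qd_norm phi2 (x, y) <= qd_norm phi1 (x, y)) ->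
  forall x y, regular_at phi2 x y ->
    h1 (x, y) - ln (qd_norm phi1 (x, y)) <= h2 (x, y) - ln (qd_norm phi2 (x, y)).
Proof.
  intros Hphi1 Hphi2 Hsol1 Hsol2 Hreg12 Hle x y Hreg.
  destruct (proj1 (proj2 Hsol1)) as [B1 HB1]; destruct (proj1 (proj2 Hsol2)) as [B2 HB2].
  assert (Hln : forall u v, regular_at phi2 u v ->
    ln (qd_norm phi2 (u, v)) <= ln (qd_norm phi1 (u, v))).
  { intros u v Huv; apply ln_le; [now apply qd_norm_pos|apply Hle, Huv]. }
  assert (Hbd : forall u v, regular_at phi2 u v -> h1 (u, v) <= B1 /\ - B2 <= h2 (u, v)).
  { intros u v [Huv _]; split.
    - apply Rle_trans with (2 := HB1 _ Huv); apply RRle_abs.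
    - generalize (HB2 _ Huv) (Rabs_maj2 (h2 (u, v))); lra. }
  enough (1 * (1 * h1 (x, y) + - 1 * ln (qd_norm phi1 (x, y)))
    + - 1 * (1 * h2 (x, y) + - 1 * ln (qd_norm phi2 (x, y))) <= 0) by lra.
  revert x y Hreg.
  pose (lap := fun (phi : C -> C) (h : C -> R) u v =>
    1 * (2 * sigma0 (u, v) * (exp (h (u, v))
      - exp (2 * ln (qd_norm phi (u, v)) - h (u, v)) - 1)) + - 1 * (- 2 * sigma0 (u, v))).
  apply (maximum_principle phi2 _
    (fun u v => 1 * lap phi1 h1 u v + - 1 * lap phi2 h2 u v) (B1 + B2) (exp (- B2)) Hphi2).
  - apply exp_pos.
  - intros u v Huv; generalize (Hln u v Huv) (Hbd u v Huv); lra.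
  - intros u v Huv; repeat apply is_laplacian_lin;
      auto using laplacian_solution, is_laplacian_ln_qd_norm.
  - intros u v Huv Hpos.
    assert (Hs := sigma0_pos u v (proj1 Huv)).
    assert (Hu2 := distortion_nonneg phi2 h2 Hphi2 Hsol2 u v Huv).
    set (w := 1 * (1 * h1 (u, v) + _) + _) in *.
    generalize (sinh_gap (ln (qd_norm phi1 (u, v))) (ln (qd_norm phi2 (u, v)))
      (h2 (u, v) - ln (qd_norm phi2 (u, v))) w (Hln u v Huv)).
    set (a := ln (qd_norm phi1 (u, v))) in *; set (b := ln (qd_norm phi2 (u, v))) in *.
    replace (a + (h2 (u, v) - b + w)) with (h1 (u, v)) by (unfold w; ring).
    replace (a - (h2 (u, v) - b + w)) with (2 * a - h1 (u, v)) by (unfold w; ring).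
    replace (b + (h2 (u, v) - b)) with (h2 (u, v)) by ring.
    replace (b - (h2 (u, v) - b)) with (2 * b - h2 (u, v)) by ring.
    intros Hgap; specialize (Hgap ltac:(lra) ltac:(lra)).
    assert (H2 : exp (- B2) <= exp (h2 (u, v))).
    { destruct (proj2 (Hbd u v Huv)) as [H| <-];
        [left; now apply exp_increasing|right; reflexivity]. }
    apply (Rmult_le_compat_r w) in H2; [|lra].
    assert (H3 := exp_pos (- B2)).
    assert (H4 : exp (- B2) * w <= 2 * ((exp (h1 (u, v)) - exp (2 * a - h1 (u, v))) -
      (exp (h2 (u, v)) - exp (2 * b - h2 (u, v))))) by nra.
    apply (Rmult_le_compat_l (sigma0 (u, v))) in H4; [|lra].
    unfold lap; fold a b; lra.
Qed.

Theorem mainTheorem3 (phi1 phi2 : C -> C) (g1 g2 : tensor2) (u1 u2 : C -> Rbar)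
    (Hphi1 : bounded_hqd phi1) (Hphi2 : bounded_hqd phi2)
    (Hg1 : associated_harmonic_metric phi1 g1)
    (Hg2 : associated_harmonic_metric phi2 g2)
    (Hu1 : is_distortion_factor phi1 g1 u1)
    (Hu2 : is_distortion_factor phi2 g2 u2)
    (Hle : forall x : C, in_disc x -> qd_norm phi1 x >= qd_norm phi2 x) :
  forall x : C, in_disc x -> Rbar_le (u1 x) (u2 x).
Proof.
  assert (Hsmooth : forall phi g, bounded_hqd phi -> associated_harmonic_metric phi g ->
    smooth_bounded_hqd phi).
  { intros phi g Hphi ([[Hg _] _] & Hhopf & _); split; [exact Hphi|].
    exact (hopf_coefficient_smooth 2 g phi Hhopf (fun i j => Hg 2%nat i j)). }
  assert (Hreg : forall x y, regular_at phi2 x y -> regular_at phi1 x y).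
  { intros x y H; split; [apply H|intros H0].
    assert (Hz : qd_norm phi1 (x, y) = 0) by (unfold qd_norm; rewrite H0, Cmod_0; lra).
    generalize (qd_norm_pos phi2 x y H) (Hle _ (proj1 H)); lra. }
  destruct Hu1 as (h1 & Hsol1 & _ & Hu1), Hu2 as (h2 & Hsol2 & _ & Hu2).
  intros [x y] Hd.
  destruct (classic (phi2 (x, y) = RtoC 0)) as [Hz|Hnz].
  - rewrite (proj1 (Hu2 _ Hd) Hz); now destruct (u1 (x, y)).
  - assert (Hx : regular_at phi2 x y) by now split.
    rewrite (proj2 (Hu1 _ Hd) (proj2 (Hreg x y Hx))), (proj2 (Hu2 _ Hd) Hnz).
    apply (distortion_comparison phi1 phi2); eauto.
    intros u v Huv; apply Rge_le, Hle, Huv.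
Qed.
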